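(* Let $G$ and $H$ be connected graphs with at least two vertices. If $o(H)\in\{\mathcal{N},\mathcal{S}\}$, then $o(G\odot H)=\mathcal{S}$.
   Context: All graphs are finite and simple. The corona product $G\odot H$ of a connected graph $G$ and a graph $H$ is obtained from one copy of $G$ and $n(G)=|V(G)|$ disjoint copies of $H$ by joining the $i$-th vertex of $G$ to every vertex of the $i$-th copy of $H$. A set $W\subseteq V(X)$ of a connected graph $X$ is a resolving set of $X$ if for every two distinct vertices $x,y$ of $X$ there is $z\in W$ such that the shortest-path distances $d_X(x,z)$ and $d_X(y,z)$ differ. The Maker-Breaker resolving game on a connected graph $X$ is played by two players, Resolver and Spoiler, who alternately select a not yet played vertex of $X$. Resolver wins if he selects all the vertices of some resolving set of $X$; Spoiler wins if she prevents this, i.e. if she selects at least one vertex from every resolving set of $X$. In the R-game Resolver moves first; in the S-game Spoiler moves first. The outcome $o(X)$ is: $\mathcal{R}$ if Resolver has a winning strategy no matter who starts the game; $\mathcal{S}$ if Spoiler has a winning strategy no matter who starts the game; $\mathcal{N}$ if the first player has a winning strategy (no matter which of the two players that is). It is known that $o(X)\in\{\mathcal{R},\mathcal{S},\mathcal{N}\}$ always holds. *)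

(* Defs.v *)
From mathcomp Require Import all_boot.

Set Implicit Arguments.
Unset Strict Implicit.
Unset Printing Implicit Defensive.

Record sgraph := SGraph {
  vertex :> finType;
  adj : rel vertex;
  adj_sym : symmetric adj;
  adj_irrefl : irreflexive adj }.

Section Graph.
Variable X : sgraph.

Definition connected : Prop := forall x y : X, connect (@adj X) x y.

Definition walk (n : nat) (x y : X) : bool :=
  [exists p : n.-tuple X, path (@adj X) x p && (last x p == y)].

(* The least length of a walk from x to y.  A shortest path has fewer than
   #|X| edges, so bounding the search by #|X| loses nothing; the value is #|X|
   when y is not reachable from x. *)
Definition dist (x y : X) : nat := find (fun n => walk n x y) (iota 0 #|X|).

Definition resolving (W : {set X}) : bool :=
  [forall x : X, forall y : X,
    (x != y) ==> [exists z in W, dist x z != dist y z]].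

End Graph.

Section Corona.
Variables G H : sgraph.

(* inl g is the vertex g of G; inr (g, h) is the vertex h in the copy of H
   attached to g. *)
Definition corona_adj (u v : G + G * H) : bool :=
  match u, v with
  | inl g, inl g' => adj g g'
  | inl g, inr (g', _) => g == g'
  | inr (g, _), inl g' => g == g'
  | inr (g, h), inr (g', h') => (g == g') && adj h h'
  end.

Lemma corona_adj_sym : symmetric corona_adj.
Proof.
by move=> [g|[g h]] [g'|[g' h']] /=; rewrite 1?adj_sym // eq_sym.
Qed.

Lemma corona_adj_irrefl : irreflexive corona_adj.
Proof. by move=> [g|[g h]] /=; rewrite adj_irrefl ?andbF. Qed.

Definition corona : sgraph := SGraph corona_adj_sym corona_adj_irrefl.

End Corona.

Definition player := bool.
Definition Resolver : player := true.
Definition Spoiler : player := false.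

Section Game.
Variable X : sgraph.

(* The player who makes move number k, moves being numbered from 0. *)
Definition turn (first : player) (k : nat) : player := first (+) odd k.

(* The game is played until every vertex is selected.  Stopping as soon as
   Resolver owns a resolving set would not change the winner, since later moves
   take no vertex away from him. *)
Definition complete_play (p : seq X) : Prop := uniq p /\ forall x : X, x \in p.

Definition selected (first : player) (p : seq X) (P : player) : {set X} :=
  [set x in p | turn first (index x p) == P].

Definition resolver_wins (first : player) (p : seq X) : Prop :=
  exists W : {set X}, resolving W /\ W \subset selected first p Resolver.

Definition spoiler_wins (first : player) (p : seq X) : Prop :=
  forall W : {set X}, resolving W ->
    exists x, x \in W /\ x \in selected first p Spoiler.

Definition wins (P first : player) (p : seq X) : Prop :=
  if P then resolver_wins first p else spoiler_wins first p.

(* A strategy maps the sequence of all moves made so far to the next move. *)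
Definition strategy := seq X -> X.

Definition legal (s : strategy) : Prop :=
  forall h : seq X, uniq h -> size h < #|X| -> s h \notin h.

Definition follows (P first : player) (s : strategy) (p : seq X) : Prop :=
  forall (h : seq X) (x : X) (t : seq X),
    p = h ++ x :: t -> turn first (size h) = P -> x = s h.

Definition has_winning_strategy (P first : player) : Prop :=
  exists s : strategy, legal s /\
    forall p, complete_play p -> follows P first s p -> wins P first p.

End Game.

Variant outcome := OutR | OutS | OutN.

(* has_outcome X o is the assertion o(X) = o. *)
Definition has_outcome (X : sgraph) (o : outcome) : Prop :=
  match o with
  | OutR => forall first, has_winning_strategy X Resolver first
  | OutS => forall first, has_winning_strategy X Spoiler first
  | OutN => forall first, has_winning_strategy X first first
  end.

(* Main.v *)
Require Import Defs.
From mathcomp Require Import all_boot.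

(** In [corona G H] two vertices of the same copy of [H] are equidistant from
    every vertex outside that copy, and inside the copy the distance is that
    of [H] truncated at 2.  Hence a resolving set of the corona meets each copy
    in a resolving set of [H], and it suffices that Spoiler wins in one copy.
    She opens in a copy in which Resolver has not played yet (there are at
    least two), following her strategy as first player on [H]; whenever
    Resolver plays elsewhere, she pretends that he has taken some free vertex of
    the copy. *)

Set Implicit Arguments.
Unset Strict Implicit.
Unset Printing Implicit Defensive.

(** * Values of game positions by backward induction *)

Section PositionValue.
Variables (T : finType) (win : pred {set T}).

(** [n] counts the moves left. Resolver's vertices are not recorded, because the result is read off
    Spoiler's set alone. *)
Fixpoint value_rec (n : nat) (t : player) (F S : {set T}) : bool :=
  if n is n'.+1 then
    if t then [forall x in F, value_rec n' Spoiler (F :\ x) S]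
    else [exists x in F, value_rec n' Resolver (F :\ x) (x |: S)]
  else win S.

(* Spoiler, owning S, can reach a set satisfying win when the free vertices
   are F and t is to move. *)
Definition value (t : player) (F S : {set T}) : bool := value_rec #|F| t F S.

Lemma value0 t S : value t set0 S = win S.
Proof. by rewrite /value cards0. Qed.

Lemma value_Resolver (F S : {set T}) x :
  value Resolver F S -> x \in F -> value Spoiler (F :\ x) S.
Proof.
rewrite /value => + xF; rewrite (cardsD1 x F) xF /= => /forall_inP.
exact.
Qed.

Lemma cardsD1_eq (F : {set T}) x y :
  x \in F -> y \in F -> #|F :\ x| = #|F :\ y|.
Proof.
by move=> xF yF; have := cardsD1 x F; rewrite (cardsD1 y F) xF yF => /addnI.
Qed.

(** On an empty [F] the second premise would be vacuous while the value is [win S]; hence the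
    nonemptiness. *)
Lemma Resolver_value (F S : {set T}) : F != set0 ->
  (forall x, x \in F -> value Spoiler (F :\ x) S) -> value Resolver F S.
Proof.
case/set0Pn=> y yF h; rewrite /value (cardsD1 y F) yF /=.
by apply/forall_inP => x xF; move: (h x xF); rewrite /value (cardsD1_eq xF yF).
Qed.

Lemma value_Spoiler (F S : {set T}) : F != set0 -> value Spoiler F S ->
  exists2 x, x \in F & value Resolver (F :\ x) (x |: S).
Proof.
case/set0Pn=> y yF; rewrite /value (cardsD1 y F) yF /=.
by case/exists_inP=> x xF vx; exists x; rewrite // /value (cardsD1_eq xF yF).
Qed.

Lemma Spoiler_value (F S : {set T}) x : x \in F ->
  value Resolver (F :\ x) (x |: S) -> value Spoiler F S.
Proof.
move=> xF vx; rewrite /value (cardsD1 x F) xF /=.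
by apply/exists_inP; exists x.
Qed.

End PositionValue.

(* The vertices of F' outside the image of F are either irrelevant or
   already conceded to Resolver in the imagined game on T. *)
Lemma value_embed (T U : finType) (winT : pred {set T}) (winU : pred {set U})
    (f : T -> U) (f_inj : injective f)
    (win_f : forall (S : {set T}) (S' : {set U}),
       winT S -> f @: S \subset S' -> winU S')
    t (F S : {set T}) (F' S' : {set U}) :
  value winT t F S -> f @: F \subset F' -> f @: S \subset S' ->
  value winU t F' S'.
Proof.
move: {2}#|F'| (leqnn #|F'|) => n.
elim: n t F S F' S' => [|n IH] t F S F' S' leF' vT sF sS.
  have F'0 : F' = set0 by apply/eqP; rewrite -cards_eq0 -leqn0.
  move: sF vT; rewrite F'0 subset0 imset_eq0 => /eqP->; rewrite !value0 => wS.
  exact: win_f wS sS.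
have [F'0|F'n0] := eqVneq F' set0.
  by apply: (IH t F S) => //; rewrite F'0 cards0.
have leD x : x \in F' -> #|F' :\ x| <= n.
  by move=> xF'; move: leF'; rewrite (cardsD1 x F') xF'.
(* Removing [x] and [y] keeps the embedding unless [y] is the image of a free vertex other than
   [x]. *)
have sD (x : T) y : (y \in f @: F -> y = f x) -> f @: (F :\ x) \subset F' :\ y.
  move=> hy; apply/subsetP => _ /imsetP[z /setD1P[zx zF] ->].
  have fzF := imset_f f zF.
  rewrite !inE (subsetP sF _ fzF) andbT.
  by apply: contraNneq zx => fz; apply/eqP/f_inj; rewrite fz -hy // -fz.
(* The imagined game is over and [S] already wins; the remaining moves in [U] cannot undo this. *)
have [F0|Fn0] := eqVneq F set0.
  have wS : winT S by move: vT; rewrite F0 value0.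
  have sF0 (A : {set U}) : f @: (set0 : {set T}) \subset A.
    by rewrite imset0 sub0set.
  case: t vT => _.
    apply: Resolver_value => // x xF'.
    by apply: (IH _ set0 S); rewrite ?value0 ?leD.
  have [x xF'] := set0Pn _ F'n0; apply: (Spoiler_value xF').
  apply: (IH _ set0 S); rewrite ?value0 ?leD //.
  exact: subset_trans sS (subsetUr _ _).
case: t vT => vT.
  apply: Resolver_value => // y yF'.
  (* Resolver's imagined move: the preimage of [y] in [F] if there is one, otherwise any vertex of
     [F]. *)
  have [x xF hx] : exists2 x, x \in F & (y \in f @: F -> y = f x).
    have [/imsetP[x xF ->]|yF] := boolP (y \in f @: F); first by exists x.
    by have [x xF] := set0Pn _ Fn0; exists x.
  by apply: (IH _ _ _ _ _ (leD y yF') (value_Resolver vT xF)) => //; apply: sD.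
have [x xF vx] := value_Spoiler Fn0 vT.
have fxF' : f x \in F' by apply: (subsetP sF); apply: imset_f.
apply: (Spoiler_value fxF'); apply: (IH _ _ _ _ _ (leD _ fxF') vx).
  exact: sD.
by rewrite imsetU1 setUS.
Qed.

(** * Winning strategies and position values *)

Section StrategyValue.
Variable X : sgraph.
Implicit Types (h p : seq X) (first : player) (S : {set X}).

Definition spoiling S : bool :=
  [forall W : {set X}, resolving W ==> (W :&: S != set0)].

Definition unplayed h : {set X} := ~: [set x in h].

Lemma spoiler_winsP first p :
  reflect (spoiler_wins first p) (spoiling (selected first p Spoiler)).
Proof.
apply: (iffP forallP) => hW W.
  by move=> rW; have /implyP/(_ rW)/set0Pn[x /setIP[]] := hW W; exists x.
by apply/implyP => /hW[x [xW xS]]; apply/set0Pn; exists x; apply/setIP.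
Qed.

Lemma turn_rcons first h x :
  turn first (size (rcons h x)) = ~~ turn first (size h).
Proof. by rewrite size_rcons /turn /= addbN. Qed.

Lemma selected_rcons first h x P : x \notin h ->
  selected first (rcons h x) P =
    if turn first (size h) == P then x |: selected first h P
    else selected first h P.
Proof.
move=> xh; apply/setP => y.
have -> : (y \in selected first (rcons h x) P) =
    if y == x then turn first (size h) == P else y \in selected first h P.
  rewrite !inE mem_rcons inE -cats1 index_cat.
  have [->|nyx] := eqVneq y x; first by rewrite (negbTE xh) /= eqxx addn0.
  by case: (y \in h).
have [->|nyx] := eqVneq y x.
  by case: ifP => _; rewrite !inE ?eqxx // (negbTE xh).
by case: ifP => _; rewrite // !inE (negbTE nyx).
Qed.

Lemma unplayed_rcons h x : unplayed (rcons h x) = unplayed h :\ x.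
Proof. by apply/setP => y; rewrite !inE mem_rcons inE negb_or. Qed.

Lemma unplayed_neq0 h : size h < #|X| -> unplayed h != set0.
Proof.
move=> lth; apply: contraTneq lth => e; rewrite -leqNgt.
apply: leq_trans (card_size h); apply/subset_leq_card/subsetP => x _.
by have := in_set0 x; rewrite -e !inE => /negbFE.
Qed.

Lemma follows_rcons P first (s : strategy X) h x :
  follows P first s h -> (turn first (size h) = P -> x = s h) ->
  follows P first s (rcons h x).
Proof.
move=> fh hx h' y t; case: (lastP t) => [|t' z].
  by rewrite cats1 => /rcons_inj[<- <-].
by rewrite -rcons_cons -rcons_cat => /rcons_inj[/fh fh' _]; apply: fh'.
Qed.

(** Every history consistent with [s] has a position won by Spoiler, by induction on the number of
    unplayed vertices: a full history is a complete play, which [s] wins. *)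
Lemma winning_strategy_value first : has_winning_strategy X Spoiler first ->
  value spoiling first setT set0.
Proof.
case=> s [legal_s win_s].
have key n h : #|unplayed h| = n -> uniq h -> follows Spoiler first s h ->
    value spoiling (turn first (size h)) (unplayed h)
      (selected first h Spoiler).
  elim: n h => [|n IH] h card_h uh fh.
    have e0 : unplayed h = set0 by apply/eqP; rewrite -cards_eq0 card_h.
    rewrite e0 value0; apply/spoiler_winsP/win_s => //; split=> // x.
    by have := in_set0 x; rewrite -e0 !inE => /negbFE.
  have n0 : unplayed h != set0 by rewrite -cards_eq0 card_h.
  have next x : x \in unplayed h ->
      (turn first (size h) = Spoiler -> x = s h) ->
      value spoiling (~~ turn first (size h)) (unplayed h :\ x)
        (if turn first (size h) == Spoiler then x |: selected first h Spoiler
         else selected first h Spoiler).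
    move=> xF hx; have xh : x \notin h by move: xF; rewrite !inE.
    rewrite -unplayed_rcons -selected_rcons // -(turn_rcons first h x).
    apply: IH; last exact: follows_rcons.
      by move: card_h; rewrite unplayed_rcons (cardsD1 x) xF => -[].
    by rewrite rcons_uniq xh.
  case: (turn first (size h)) next => next.
    by apply: Resolver_value => // x xF; apply: next.
  have sF : s h \in unplayed h.
    rewrite !inE; apply: legal_s => //.
    have [x] := set0Pn _ n0; rewrite !inE => xh.
    rewrite -(card_uniqP uh) -cardsT; apply: proper_card.
    by apply/properP; split; [apply/subsetP => y; rewrite inE | exists x].
  by apply: (Spoiler_value sF); apply: next.
have e0 : unplayed [::] = setT by apply/setP => x; rewrite !inE.
have e1 : selected first [::] Spoiler = set0 :> {set X}.
  by apply/setP => x; rewrite !inE.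
have := key _ [::] erefl isT.
rewrite e0 e1 /turn addbF; apply.
by case.
Qed.

(** Spoiler always picks a move that keeps the value; it then survives to the end of the play, where
    it says that her set is spoiling. *)
Lemma value_winning_strategy first (x0 : X) : value spoiling first setT set0 ->
  has_winning_strategy X Spoiler first.
Proof.
move=> v0.
pose good h x := value spoiling Resolver (unplayed h :\ x)
  (x |: selected first h Spoiler).
(* The fallback to any unplayed vertex keeps [s] legal on lost positions; [x0] is returned only when
   all vertices are played. *)
pose s h := if [pick x in unplayed h | good h x] is Some x then x
  else odflt x0 [pick x in unplayed h].
exists s; split.
  move=> h uh /unplayed_neq0 /set0Pn[y yF].
  suff: s h \in unplayed h by rewrite !inE.
  rewrite /s; case: pickP => [x /andP[]//|_] /=.
  by case: pickP => // /(_ y); rewrite yF.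
move=> p [up allp] fp; apply/spoiler_winsP.
suff key h t : p = h ++ t -> value spoiling (turn first (size h)) (unplayed h)
    (selected first h Spoiler).
  have := key p [::]; rewrite cats0 => /(_ erefl).
  have -> : unplayed p = set0 by apply/setP => x; rewrite !inE allp.
  by rewrite value0.
elim/last_ind: h t => [|h x IH] t.
  have -> : unplayed [::] = setT by apply/setP => x; rewrite !inE.
  have -> : selected first [::] Spoiler = set0 :> {set X}.
    by apply/setP => x; rewrite !inE.
  by rewrite /turn addbF.
rewrite cat_rcons => def_p.
have xh : x \notin h.
  by move: up; rewrite def_p cat_uniq /= negb_or => /and3P[_ /andP[]].
have xF : x \in unplayed h by rewrite !inE.
rewrite turn_rcons unplayed_rcons selected_rcons //.
move: (IH _ def_p) (fp _ _ _ def_p).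
case: (turn first (size h)) => /= v hx; first exact: value_Resolver.
rewrite (hx erefl) /s; case: pickP => [y /andP[]//|no].
have n0 : unplayed h != set0 by apply/set0Pn; exists x.
have [y yF gy] := value_Spoiler n0 v.
by have := no y; rewrite yF /good gy.
Qed.

End StrategyValue.

(** * Walks of given length and distances *)

Section Walks.
Variable X : sgraph.

Lemma walk0 (x y : X) : walk 0 x y = (x == y).
Proof.
apply/existsP/idP => [[p]|xy]; first by rewrite (tuple0 p).
by exists [tuple].
Qed.

Lemma walkS n (x y : X) : walk n.+1 x y = [exists z, adj x z && walk n z y].
Proof.
apply/existsP/existsP => [[p]|[z /andP[xz /existsP[p /andP[pp lp]]]]].
  case/tupleP: p => z p /= /andP[/andP[xz pp] lp]; exists z; rewrite xz.
  by apply/existsP; exists p; rewrite pp.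
by exists [tuple of z :: p]; rewrite /= xz pp.
Qed.

Lemma walk1 (x y : X) : walk 1 x y = adj x y.
Proof.
rewrite walkS; apply/existsP/idP => [[z]|xy].
  by rewrite walk0 => /andP[xz /eqP<-].
by exists y; rewrite walk0 eqxx xy.
Qed.

Lemma eq_walk_dist (x y z : X) :
  (forall n, walk n x z = walk n y z) -> dist x z = dist y z.
Proof. by move=> e; apply: eq_find. Qed.

(** With two vertices the search in [dist] tests lengths 0 and 1, so the values 0 and 1 detect
    equality and adjacency. *)
Lemma dist_eq_adj (x y z : X) : 2 <= #|X| -> dist x z = dist y z ->
  (x == z) = (y == z) /\ adj x z = adj y z.
Proof.
rewrite /dist; case: #|X| => [|[|n]] //= _; rewrite !walk0 !walk1.
have [->|_] := eqVneq x z; have [->|_] := eqVneq y z => //=;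
  try by case: ifP.
by case: (adj x z); case: (adj y z).
Qed.

Lemma connected_neighbour (x : X) : connected X -> 2 <= #|X| ->
  exists y, adj x y.
Proof.
move=> conn; rewrite (cardD1 x) inE /= => /card_gt0P[y].
rewrite !inE andbT => yx.
case/connectP: (conn x y) => -[|z p] /=; last by case/andP=> xz _ _; exists z.
by move=> _ e; rewrite e eqxx in yx.
Qed.

End Walks.

(** * Distances and resolving sets in one copy of [H] *)

Section CoronaResolving.
Variables (G H : sgraph).
Hypotheses (connH : connected H) (H_ge2 : 2 <= #|H|).
Variable g : G.

Definition copy (h : H) : corona G H := inr (g, h).

Lemma copy_inj : injective copy.
Proof. by move=> h h' []. Qed.

(** The walk can leave the copy only through [inl g]. Until then its steps are matched one by one by
    steps to arbitrary neighbours in [H], and [inl g] can be entered from anywhere in the copy. *)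
Lemma walk_copy_outside n (x y : H) (z : corona G H) :
  z \notin codom copy -> walk n (copy x) z -> walk n (copy y) z.
Proof.
move=> zout; elim: n x y => [|n IH] x y.
  by rewrite walk0 => /eqP e; rewrite -e codom_f in zout.
rewrite !walkS => /existsP[w /andP[]].
case: w => [g'|[g' x']] /= xw ww.
  by apply/existsP; exists (inl g'); rewrite xw ww.
case/andP: xw => /eqP eg _; subst g'.
have [y' yy'] := connected_neighbour y connH H_ge2.
by apply/existsP; exists (copy y'); rewrite /= eqxx yy' (IH _ _ ww).
Qed.

Lemma walk_copy_ge2 n (x y : H) : walk n.+2 (copy x) (copy y).
Proof.
elim: n x => [|n IH] x; rewrite walkS; apply/existsP.
  by exists (inl g); rewrite walk1 /= eqxx.
have [x' xx'] := connected_neighbour x connH H_ge2.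
by exists (copy x'); rewrite IH /= eqxx xx'.
Qed.

Lemma dist_copy_outside (x y : H) (z : corona G H) :
  z \notin codom copy -> dist (copy x) z = dist (copy y) z.
Proof.
by move=> zout; apply: eq_walk_dist => n; apply/idP/idP; apply: walk_copy_outside.
Qed.

(** Walks of length 0 and 1 are decided by equality and adjacency in [H]; from length 2 on, using
    [inl g], they always exist. *)
Lemma dist_copy_inside (x y z : H) : dist x z = dist y z ->
  dist (copy x) (copy z) = dist (copy y) (copy z).
Proof.
case/(dist_eq_adj H_ge2) => e0 e1; apply: eq_walk_dist => -[|[|n]].
- by rewrite !walk0 !(inj_eq copy_inj).
- by rewrite !walk1 /= e1.
- by rewrite !walk_copy_ge2.
Qed.

Lemma resolving_copy (W : {set corona G H}) :
  resolving W -> resolving (copy @^-1: W).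
Proof.
move=> rW; apply/forallP => x; apply/forallP => y; apply/implyP => xy.
have /forallP/(_ (copy x))/forallP/(_ (copy y))/implyP := rW.
rewrite (inj_eq copy_inj) => /(_ xy)/exists_inP[z zW dz].
have [/codomP[h zh]|zout] := boolP (z \in codom copy); last first.
  by rewrite (dist_copy_outside x y zout) eqxx in dz.
subst z; apply/exists_inP; exists h; first by rewrite inE.
by apply: contra_neq dz; apply: dist_copy_inside.
Qed.

Lemma spoiling_copy (S : {set H}) (S' : {set corona G H}) :
  spoiling S -> copy @: S \subset S' -> spoiling S'.
Proof.
move=> /forallP sS sSS'; apply/forallP => W; apply/implyP => /resolving_copy rW.
have /implyP/(_ rW)/set0Pn[x /setIP[]] := sS (copy @^-1: W).
rewrite inE => xW xS; apply/set0Pn; exists (copy x); rewrite inE xW.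
by apply: (subsetP sSS'); apply: imset_f.
Qed.

End CoronaResolving.

Theorem proposition3p1 (G H : sgraph)
    (connG : connected G) (connH : connected H)
    (G_ge2 : 2 <= #|G|) (H_ge2 : 2 <= #|H|) :
  has_outcome H OutN \/ has_outcome H OutS -> has_outcome (corona G H) OutS.
Proof.
move=> oH.
(* Under either outcome Spoiler wins on [H] when she starts. *)
have vH : value (@spoiling H) Spoiler setT set0.
  by apply: winning_strategy_value; case: oH => /(_ Spoiler).
have vG g (F : {set corona G H}) : (forall h, copy g h \in F) ->
    value (@spoiling _) Spoiler F set0.
  move=> sF; apply: (value_embed (@copy_inj G H g) _ vH).
  - exact: spoiling_copy.
  - by apply/subsetP => _ /imsetP[h _ ->].
  - by rewrite imset0.
have /card_gt0P[g0 _] : 0 < #|G| by apply: ltnW.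
move=> first; apply: (value_winning_strategy (inl g0 : corona G H)).
case: first; last by apply: (vG g0) => h; rewrite inE.
apply: Resolver_value => [|x _]; first by apply/set0Pn; exists (inl g0).
(* [gx] indexes the part of the corona where Resolver opened; any other copy is still untouched. *)
pose gx := match x with inl g => g | inr (g, _) => g end.
have [g ngx] : exists g, g != gx.
  move: G_ge2; rewrite (cardD1 gx) inE => /card_gt0P[g].
  by rewrite !inE andbT; exists g.
apply: (vG g) => h; rewrite !inE andbT.
by apply: contraNneq ngx => e; rewrite /gx -e.
Qed.
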